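(* Let $K$ be a field, $S=K[x_1,\ldots,x_n]$, and let $d\ge 1$ and $a_1,\ldots,a_n$ be nonnegative integers with $d\geq a_1\geq a_2\geq\cdots\geq a_n$ and $\sum_{i=1}^n a_i\geq d$. Let $I=I_{d;a_1,\ldots,a_n}\subset S$ be the corresponding ideal of Veronese type. Then $I$ is equidimensional if and only if there exists a pair $(p,l)$ of integers with $n\geq p\geq l\geq 1$ that satisfies conditions (i) and (ii) below and is maximal, with respect to the partial order given by componentwise comparison, among the pairs satisfying them: (i) $a_{p-l+1}+\cdots+a_p\geq d$ and $a_{p-l+1}+\cdots+a_{p-1}<d$; (ii) for any sequence $i_1<\cdots<i_k$ in $[n]=\{1,\ldots,n\}$ (with $k\geq1$) with $a_{i_1}+\cdots+a_{i_k}\geq d$ and $a_{i_1}+\cdots+a_{i_{k-1}}<d$, one has $i_k-k\leq p-l$.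
   Context: The ideal of Veronese type $I_{d;a_1,\ldots,a_n}\subset S$ is the ideal generated by all monomials $x_1^{u_1}\cdots x_n^{u_n}$ with $u_1+\cdots+u_n=d$ and $0\leq u_i\leq a_i$ for all $i$. An ideal $J$ of $S$ is equidimensional if $\dim(S/\mathfrak p)$ is the same number for all minimal primes $\mathfrak p$ of $J$. Empty sums are $0$. Componentwise comparison: $(p,l)\leq(p',l')$ if $p\leq p'$ and $l\leq l'$. *)

(* Defs.v *)
From HB Require Import structures.
From mathcomp Require Import all_boot all_order all_algebra.
From mathcomp Require Export ring_quotient mpoly.

Set Implicit Arguments.
Unset Strict Implicit.
Unset Printing Implicit Defensive.

Import GRing.Theory.
Local Open Scope ring_scope.

Section CommutativeAlgebra.
Variable R : comNzRingType.

Definition ideal_gen (G : R -> Prop) (f : R) : Prop :=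
  exists2 s : seq (R * R),
    (forall u, u \in s -> G u.2) & f = \sum_(u <- s) u.1 * u.2.

(* [prime_idealr R] consists of boolean predicates; with classical logic and
   choice every prime ideal of R is one. *)
Definition prime_over (J : R -> Prop) (P : prime_idealr R) : Prop :=
  forall f, J f -> f \in P.

Definition minimal_prime (J : R -> Prop) (P : prime_idealr R) : Prop :=
  prime_over J P /\
  forall Q : prime_idealr R,
    prime_over J Q -> {subset Q <= P} -> {subset P <= Q}.

(* Strictly increasing chains c_0 < ... < c_m of m + 1 prime ideals. *)
Definition prime_chain (m : nat) (c : 'I_m.+1 -> prime_idealr R) : Prop :=
  forall i j : 'I_m.+1, (i < j)%N ->
    {subset c i <= c j} /\ ~ {subset c j <= c i}.

Definition has_krull_dim (m : nat) : Prop :=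
  (exists c : 'I_m.+1 -> prime_idealr R, prime_chain c) /\
  forall k (c : 'I_k.+1 -> prime_idealr R), prime_chain c -> (k <= m)%N.

End CommutativeAlgebra.

(* The common dimension is asked to be a natural number, which is no
   restriction for quotients of polynomial rings over a field. *)
Definition equidimensional (R : comNzRingType) (J : R -> Prop) : Prop :=
  exists m : nat, forall P : prime_idealr R,
    minimal_prime J P -> has_krull_dim {ideal_quot P} m.

Definition veronese_ideal (K : fieldType) (n d : nat) (a : 'I_n -> nat) :
    {mpoly K[n]} -> Prop :=
  ideal_gen (fun f => exists u : 'X_{1..n},
    [/\ mdeg u = d, forall i, (u i <= a i)%N & f = 'X_[u]]).
Arguments veronese_ideal K {n} d a f.

(* [a i] is the exponent bound a_(i.+1) of the 1-based indexing, in which all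
   index bounds below are written. *)
Section Pairs.
Variables (n d : nat) (a : 'I_n -> nat).
Local Open Scope nat_scope.

Definition reaches_degree (p l : nat) : Prop :=
  d <= \sum_(i < n | p - l + 1 <= i.+1 <= p) a i /\
  \sum_(i < n | p - l + 1 <= i.+1 <= p - 1) a i < d.

(* The sequence i_1 < ... < i_k is [rcons s t], so that t.+1 = i_k and
   k = (size s).+1; being increasing, it has k <= i_k. *)
Definition offsets_bounded (p l : nat) : Prop :=
  forall (s : seq 'I_n) (t : 'I_n),
    sorted (fun i j : 'I_n => i < j) (rcons s t) ->
    d <= \sum_(i <- rcons s t) a i ->
    \sum_(i <- s) a i < d ->
    t.+1 - (size s).+1 <= p - l.

Definition admissible (p l : nat) : Prop :=
  [/\ 1 <= l, l <= p, p <= n, reaches_degree p l & offsets_bounded p l].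

Definition maximal_admissible (p l : nat) : Prop :=
  admissible p l /\
  forall p' l', admissible p' l' -> p <= p' -> l <= l' -> p' = p /\ l' = l.

End Pairs.

(* Main.v *)
Require Import Defs.
From mathcomp Require Import all_boot all_order all_algebra.
From HB Require Import structures.
From mathcomp Require Import zify.
From Stdlib Require Import Classical_Prop.

(* The minimal primes of the ideal are the ideals (x_i : i \notin B), where B
   runs over the maximal sets of indices with sum of bounds less than d, and
   the quotient by such a prime has dimension #|B|.  So equidimensionality says
   that all these B have the same cardinality.  The largest B is a final segment
   {i > q}, and the others have size n - (i_k - k) - 1 for the sequences of
   condition (ii), so the cardinalities agree iff the window starting after the
   largest offset i_k - k still reaches d.

   The dimension bound: if P_0 < ... < P_k are primes and f_i lies in
   P_(i+1) but not in P_i, then looking at lowest exponents of f_0, then f_1,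
   etc. shows that f_0, ..., f_(k-1) are algebraically independent modulo P_0;
   counting monomials shows that this forces k to be at most the number of
   variables outside P_0. *)

Set Implicit Arguments.
Unset Strict Implicit.
Unset Printing Implicit Defensive.

Import GRing.Theory.

(** * Maximal light sets and admissible pairs *)

Section Combinatorics.
Local Open Scope nat_scope.
Variables (n d : nat) (a : 'I_n -> nat).
Hypothesis d_ge1 : 1 <= d.
Hypothesis a_noninc : forall i j : 'I_n, i <= j -> a j <= a i.
Implicit Types (B C : {set 'I_n}).
(** The light sets are those that contain the support of no generator, hence the faces of the
    Stanley-Reisner complex of the radical of the ideal. *)
Definition light B : bool := \sum_(i in B) a i < d.

Lemma card_ord_ltn (h : nat) : h <= n -> #|[set i : 'I_n | i < h]| = h.
Proof.
by move=> lehn; rewrite -sum1dep_card (big_ord_narrow lehn) sum1_card card_ord.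
Qed.

(** The tail [T] carries the smallest bounds. Bounds on [T :\: C] are at most [v], those on
    [C :\: T] at least [v], and [C :\: T] has at least as many elements. *)
Lemma tail_sum_le (h : nat) C :
  n - h <= #|C| -> \sum_(i < n | h <= i) a i <= \sum_(i in C) a i.
Proof.
move=> hC; have [lthn|lenh] := ltnP h n; last first.
  by rewrite big1 // => i; rewrite leqNgt (leq_trans (ltn_ord i)).
pose T := [set i : 'I_n | h <= i]; pose v := a (Ordinal lthn).
have cT : #|T| = n - h.
  have -> : T = ~: [set i : 'I_n | i < h] by apply/setP=> i;
    rewrite !inE -leqNgt.
  by have := cardsC [set i : 'I_n | i < h];
    rewrite card_ord_ltn ?(ltnW lthn) // card_ord; lia.
have -> : \sum_(i < n | h <= i) a i = \sum_(i in T) a i by apply: eq_bigl => i;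
  rewrite inE.
rewrite (big_setID C) [leqRHS](big_setID T) /= setIC leq_add2l.
apply: (@leq_trans (#|T :\: C| * v)).
  rewrite -sum_nat_const; apply: leq_sum => i /[!inE] /andP[_ hi].
  exact: a_noninc.
apply: (@leq_trans (#|C :\: T| * v)).
  rewrite leq_mul2r; apply/orP; right.
  have e1 := cardsID C T; have e2 := cardsID T C; rewrite setIC in e2.
  by move: hC; rewrite -cT -e1 -e2 leq_add2l.
rewrite -sum_nat_const; apply: leq_sum => i /[!inE] /andP[].
by rewrite -ltnNge => /ltnW hi _; apply: a_noninc.
Qed.

(** With [h = p - l], a set of at least [n - h] indices is at least as heavy as the tail from [h],
    which reaches [d]; so [#|B| < n - h]. For the other inequality, adding to [B] the last index [t]
    outside it gives a heavy set, whose shortest initial part reaching [d] is a sequence of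
    condition (ii); its offset bounds [#|~: B|]. *)
Lemma card_maxset_light_of_offsets p l B :
  1 <= l <= p -> p <= n -> d <= \sum_(i < n | p - l + 1 <= i.+1 <= p) a i ->
  offsets_bounded d a p l -> maxset light B -> #|B| = n - (p - l).+1.
Proof.
move=> /andP[l1 lp] pn dw offs /maxsetP[lB maxB].
set h := p - l in dw offs *.
have tail_h : d <= \sum_(i < n | h <= i) a i.
  apply: leq_trans dw _; rewrite big_mkcond [leqRHS]big_mkcond /=.
  by apply: leq_sum => i _; rewrite addn1 ltnS; case: (h <= i) => //=;
    case: ifP.
have ubB : #|B| < n - h.
  by rewrite ltnNge; apply/negP => /tail_sum_le; move: lB tail_h;
    rewrite /light; lia.
have cB : #|~: B| = n - #|B| by have := cardsC B; rewrite card_ord => e;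
  rewrite -[X in X - _]e addKn.
have [t0 Bt0] : exists t, t \in ~: B by apply/set0Pn; rewrite -card_gt0; lia.
have [t Bt maxt] : exists2 t, t \notin B & forall j, j \notin B -> j <= t.
  have [t Bt maxt] := arg_maxnP (P := mem (~: B)) (fun i : 'I_n => val i) Bt0.
  by exists t => [|j Bj]; [rewrite /= inE in Bt | apply: maxt; rewrite /= inE].
pose C := t |: B.
have dC : d <= \sum_(i in C) a i.
  rewrite leqNgt; apply/negP => lC; move: Bt.
  by rewrite -(maxB C lC (subsetUr _ _)) setU11.
have exr : exists r, d <= \sum_(i in C | i < r) a i.
  by exists n; under eq_bigl do rewrite ltn_ord andbT.
have [r dr minr] := ex_minnP exr.
have r_gt0 : 0 < r.
  by rewrite lt0n; apply: contraTneq dr => ->;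
    rewrite big_pred0 -?ltnNge // => i; rewrite andbF.
have sum_lt : \sum_(i in C | i < r.-1) a i < d.
  by rewrite ltnNge; apply/negP => /minr; lia.
(* If [r.-1] were not in [C], the cut at [r.-1] would have the same sum, against the minimality of
   [r]. *)
have [u Cu ur] : exists2 u : 'I_n, u \in C & u = r.-1 :> nat.
  apply: NNPP => noU; move: sum_lt; rewrite ltnNge; case/negP.
  apply: leq_trans dr _; apply: eq_leq; apply: eq_bigl => i.
  have [Ci|//] := boolP (i \in C); rewrite /=.
  have : i <> r.-1 :> nat by move=> ir; apply: noU; exists i.
  by lia.
pose s := [seq i <- enum 'I_n | (i \in C) && (i < u)].
have dsum : \sum_(i in C | i < r) a i = \sum_(i in C | i < u) a i + a u.
  rewrite (bigD1 u) /=; last by rewrite Cu; lia.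
  rewrite addnC; congr (_ + _); apply: eq_bigl => i; rewrite -andbA;
    congr (_ && _).
  by rewrite -val_eqE /=; lia.
have sumE : \sum_(i <- s) a i = \sum_(i in C | i < u) a i
  by rewrite big_filter big_enum_cond.
have sizeE : size s = #|[set i in C | i < u]|.
  by rewrite -sum1_size big_filter big_enum_cond sum1dep_card.
have off : u.+1 - (size s).+1 <= h.
  apply: offs.
  - have tr : transitive (fun i j : 'I_n => i < j) by move=> ? ? ?;
      apply: ltn_trans.
    rewrite sorted_pairwise // pairwise_rcons -sorted_pairwise //; apply/andP;
      split.
      by apply/allP=> i; rewrite mem_filter => /andP[/andP[]].
    apply: sorted_filter => //.
    by have := iota_ltn_sorted 0 n; rewrite -val_enum_ord sorted_map.
  - by rewrite -cats1 big_cat big_seq1 /= sumE -dsum.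
  - by rewrite sumE ur.
(* If [u < t], the part of [C] below [r] would avoid [t] and lie in the light set [B]. *)
have tu : t <= u.
  rewrite leqNgt; apply/negP => ltut; move: lB; rewrite /light ltnNge;
    case/negP.
  apply: leq_trans dr _; rewrite big_mkcond [leqRHS]big_mkcond /=.
  apply: leq_sum => i _; case: ifP => // /andP[/setU1P[->|->//]]; lia.
(* An index outside [B] is [t] itself or is below [t <= u] and outside [C]; there are [u - size s]
   indices below [u] outside [C]. *)
have : #|~: B| <= (u - size s).+1.
  pose X := [set i : 'I_n | i < u]; pose Y := [set i in C | i < u].
  have YX : Y \subset X by apply/subsetP=> i /[!inE] /andP[].
  have sub : ~: B \subset t |: (X :\: Y).
    apply/subsetP=> i /[!inE] Bi; have := maxt i Bi.
    rewrite leq_eqVlt => /orP[/eqP/val_inj->|ltit]; first by rewrite eqxx.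
    have -> : i < u by lia.
    by rewrite -val_eqE /= (ltn_eqF ltit) (negPf Bi).
  apply: leq_trans (subset_leq_card sub) _; rewrite cardsU1 cardsDS // -sizeE.
  by rewrite card_ord_ltn ?(ltnW (ltn_ord u)) //; case: (_ \notin _); lia.
lia.
Qed.

(** Take the last [q] from which the tail reaches [d], and the shortest window starting there that
    reaches [d]. The tail after [q] is a maximal light set, so [m = n - q.+1], and this common size
    bounds all offsets by [q]. *)
Lemma admissible_of_card_maxset m :
  d <= \sum_(i < n) a i -> (forall B, maxset light B -> #|B| = m) ->
  exists p l, admissible d a p l.
Proof.
move=> sum_a mP.
have ex0 : exists q, d <= \sum_(i < n | q <= i) a i by exists 0.
have qub q : d <= \sum_(i < n | q <= i) a i -> q <= n.
  move=> dq; rewrite leqNgt; apply: contraTN dq => ltnq.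
  rewrite -ltnNge big_pred0 // => i; apply/negbTE; rewrite -ltnNge.
  exact: ltn_trans (ltn_ord i) ltnq.
have [q dq maxq] := ex_maxnP ex0 qub.
have ltqn : q < n.
  rewrite ltnNge; apply: contraTN dq => lenq.
  rewrite -ltnNge big_pred0 // => i; apply/negbTE; rewrite -ltnNge.
  exact: leq_trans (ltn_ord i) lenq.
have tail_lt : \sum_(i < n | q < i) a i < d.
  by rewrite ltnNge; apply/negP => /maxq; rewrite ltnn.
have mE : m = n - q.+1.
  pose B := [set i : 'I_n | q < i].
  have sumB : \sum_(i in B) a i = \sum_(i < n | q < i) a i.
    by apply: eq_bigl => i; rewrite inE.
  rewrite -(mP B).
    have -> : B = ~: [set i : 'I_n | i < q.+1] by apply/setP=> i;
      rewrite !inE -ltnNge.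
    have e := cardsC [set i : 'I_n | i < q.+1];
      rewrite card_ord_ltn // card_ord in e.
    by rewrite -[X in X - _]e addKn.
  apply/maxsetP; split=> [|B' lB' sB]; first by rewrite /light sumB.
  (* An index [i <= q] has bound at least that of [q], and [B] together with [q] already reaches
     [d]. *)
  apply/eqP; rewrite eqEsubset sB andbT; apply/subsetP=> i B'i.
  apply: contraLR lB' => Bi; rewrite /light -leqNgt (big_setID B) /= (setIidPr
    sB) sumB.
  apply: leq_trans dq _; rewrite (bigD1 (Ordinal ltqn)) //= addnC leq_add //.
    by apply: eq_leq; apply: eq_bigl => j; rewrite -val_eqE /=; lia.
  rewrite (bigD1 i) /=; last by rewrite inE Bi.
  apply: leq_trans (leq_addr _ _); apply: a_noninc => /=.
  by move: Bi; rewrite inE -leqNgt.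
have ex1 : exists p, d <= \sum_(i < n | q <= i < p) a i.
  by exists n; apply: leq_trans dq _;
    under [leqRHS]eq_bigl do rewrite ltn_ord andbT.
have [p dp minp] := ex_minnP ex1.
have ltqp : q < p.
  rewrite ltnNge; apply: contraTN dp => lepq.
  by rewrite -ltnNge big_pred0 // => i; apply/negbTE; lia.
have lepn : p <= n.
  by apply: minp; apply: leq_trans dq _;
    under [leqRHS]eq_bigl do rewrite ltn_ord andbT.
exists p, (p - q); rewrite /admissible /reaches_degree /offsets_bounded.
have -> : p - (p - q) = q by lia.
split=> [|||| s t st ds ls]; [lia | lia | by [] | split | ].
- by under eq_bigl do rewrite addn1 ltnS.
- rewrite ltnNge; apply/negP => dp'.
  have : p <= p - 1; last by lia.
  by apply: minp; under eq_bigl do rewrite -[q <= _]ltnS -addn1.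
have ltr : transitive (fun i j : 'I_n => i < j) by move=> ? ? ?;
  apply: ltn_trans.
have := st; rewrite sorted_pairwise // pairwise_rcons -sorted_pairwise // =>
  /andP[/allP s_lt_t s_sorted].
have s_uniq : uniq s by apply: sorted_uniq s_sorted => // i; rewrite /= ltnn.
have sumS : \sum_(i in [set i in s]) a i = \sum_(i <- s) a i.
  by rewrite [RHS]big_uniq //; apply: eq_bigl => i; rewrite inE.
(* An index [i <= t] outside [s] cannot lie in a maximal light [Y] containing [s]: its bound is at
   least [a t], and [s] with [t] reaches [d]. So all [t.+1 - size s] such indices lie in [~: Y],
   which has [q.+1] elements. *)
have [Y maxY sY] : {Y | maxset light Y & [set i in s] \subset Y}.
  by apply: maxset_exists; rewrite /light sumS.
have cY : #|~: Y| = q.+1.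
  by have := cardsC Y; rewrite (mP Y maxY) card_ord mE; lia.
pose X := [set i : 'I_n | i < t.+1].
have sX : [set i in s] \subset X.
  by apply/subsetP=> i /[!inE] /s_lt_t /=; apply: leqW.
have sub : X :\: [set i in s] \subset ~: Y.
  apply/subsetP=> i; rewrite !inE => /andP[nsi leit]; apply/negP => Yi.
  have := maxsetp maxY; rewrite /light ltnNge; case/negP.
  apply: leq_trans ds _; rewrite -cats1 big_cat big_seq1 /= -sumS.
  rewrite [leqRHS](big_setID [set i in s]) /= (setIidPr sY) leq_add2l.
  rewrite (bigD1 i) /=; last by rewrite !inE nsi.
  by apply: leq_trans (leq_addr _ _); apply: a_noninc.
have := subset_leq_card sub; rewrite cY cardsDS // card_ord_ltn ?ltn_ord //.
by rewrite cardsE (card_uniqP s_uniq) !leq_subLR addSnnS.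
Qed.

(** Passing to a larger pair increases [p + l], which never exceeds [n + n]. *)
Lemma maximal_admissible_of_admissible p l :
  admissible d a p l -> exists p l, maximal_admissible d a p l.
Proof.
have [k] := ubnP (n + n - (p + l)); elim: k p l => // k IHk p l ltk adm.
have [[p' [l' [adm' lep lel ne]]]|nex] := classic (exists p' l',
    [/\ admissible d a p' l', p <= p', l <= l' & p + l <> p' + l']).
  by apply: (IHk p' l' _ adm'); case: adm' => *; lia.
exists p, l; split=> // p' l' adm' lep lel; apply: NNPP => ne; apply: nex.
by exists p', l'; split=> //; lia.
Qed.

End Combinatorics.

(** * Chains of primes in quotients of polynomial rings *)

Section Algebra.
Local Open Scope ring_scope.
Local Open Scope quotient_scope.

Lemma notin_prime_expM (R : comNzRingType) (P : prime_idealr R) x y m :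
  x \notin P -> x ^+ m * y \in P -> y \in P.
Proof.
move=> xP; elim: m y => [|m IHm] y; first by rewrite expr0 mul1r.
by rewrite exprSr -mulrA => /IHm; rewrite prime_idealrM (negPf xP).
Qed.

(* The monomials of the lowest exponent m of f_0 give f_0 ^ m * X, the others
  lie
   in f_0 ^ (m + 1) R; so if the sum is in P_0, then X is in P_1. *)
Lemma chain_independent (R : comNzRingType) (K : fieldType)
    (iota : {rmorphism K -> R}) (I : finType) (c : I -> K) (k : nat)
    (P : nat -> prime_idealr R) (f : nat -> R) (e : I -> nat -> nat)
    (S : {set I}) :
  (forall t, (t < k)%N ->
     [/\ {subset P t <= P t.+1}, f t \in P t.+1 & f t \notin P t]) ->
  (forall i, i \in S -> c i != 0) -> S != set0 ->
  {in S &, forall i j, (forall t, (t < k)%N -> e i t = e j t) -> i = j} ->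
  \sum_(i in S) iota (c i) * \prod_(t < k) f t ^+ e i t \notin P 0%N.
Proof.
elim: k P f e S => [|k IHk] P f e S chP cS /set0Pn[i0 Si0] injS.
  have -> : S = [set i0].
    apply/setP=> i; rewrite inE; apply/idP/eqP => [Si|->] //.
    by apply: injS.
  rewrite big_set1 big_ord0 mulr1; apply/negP => /(idealMr (iota (c i0)^-1)).
  by rewrite -rmorphM mulVf ?cS // rmorph1 idealr1.
have [i1 Si1 min1] : exists2 i, i \in S & forall j, j \in S -> (e i 0 <= e j
  0)%N.
  by have [i] := arg_minnP (P := mem S) (fun i => e i 0%N) Si0; exists i.
set m := e i1 0%N in min1; pose T := [set i in S | e i 0%N == m].
have [sP01 f0P1 f0P0] := chP 0%N isT.
have: \sum_(i in T) iota (c i) * \prod_(t < k) f t.+1 ^+ e i t.+1 \notin P 1%N.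
  apply: (IHk (fun t => P t.+1) (fun t => f t.+1) (fun i t => e i t.+1)).
  - by move=> t tk; apply: chP.
  - by move=> i /[!inE] /andP[/cS].
  - by apply/set0Pn; exists i1; rewrite inE Si1 /=.
  move=> i j /[!inE] /andP[Si /eqP ei] /andP[Sj /eqP ej] eqe.
  by apply: injS => // -[|t] tk; [rewrite ei | apply: eqe].
apply: contra.
rewrite (big_setID T) /= (setIidPr _); last
  by apply/subsetP=> i /[!inE] /andP[].
under eq_bigr => i /[!inE] /andP[_ /eqP ei].
  rewrite big_ord_recl /= ei mulrCA.
  rewrite /bump /=; over.
rewrite -mulr_sumr.
under [X in _ + X]eq_bigr => i.
  rewrite !inE => Hi.
  have lt_m : (m < e i 0%N)%N.
    case/andP: Hi => + Si; rewrite Si /= => ne.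
    by rewrite ltn_neqAle eq_sym ne min1.
  rewrite big_ord_recl /= mulrCA -(subnKC lt_m) exprD exprS -!mulrA.
  rewrite (mulrCA (f 0%N)); over.
rewrite -mulr_sumr -mulrDr => /(notin_prime_expM f0P0)/sP01.
set X := \sum_(i in T) _.
set Y := \sum_(i in _) _ => XYP.
have YP : Y \in P 1%N.
  by apply: rpred_sum => i _; rewrite mulrC idealMr // mulrC.
by rewrite -[X](addrK Y) rpredB.
Qed.

(** A matrix with more rows than columns has a nonzero vector in its left kernel. *)
Lemma linear_dependence (K : fieldType) (I J : finType) (F : I -> J -> K) :
  (#|J| < #|I|)%N ->
  exists c : I -> K, (exists i, c i != 0) /\
    forall j, \sum_i c i * F i j = 0.
Proof.
move=> ltJI.
pose M := \matrix_(i < #|I|, j < #|J|) F (enum_val i) (enum_val j).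
have : kermx M != 0.
  rewrite -mxrank_eq0 mxrank_ker subn_eq0 -ltnNge.
  exact: leq_ltn_trans (rank_leq_col M) ltJI.
case/rowV0Pn => v /sub_kermxP vM /matrix0Pn[i1 [i vi]].
exists (fun i => v 0 (enum_rank i)); split.
  by exists (enum_val i); rewrite enum_valK -(ord1 i1).
move=> j; have /rowP/(_ (enum_rank j)) := vM; rewrite !mxE => vMj.
rewrite (reindex (@enum_val I predT)) /=; last first.
  by apply: onW_bij; apply: enum_val_bij.
rewrite -[RHS]vMj; apply: eq_bigr => l _.
by rewrite mxE enum_valK enum_rankK.
Qed.

(** [msize] is the degree plus one, and 0 at the zero polynomial; this form of the degree bound
    covers zero factors too. *)
Lemma msize_mul_le (K : fieldType) n (p q : {mpoly K[n]}) x y :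
  (msize p <= x.+1)%N -> (msize q <= y.+1)%N -> (msize (p * q) <= (x + y).+1)%N.
Proof.
move=> px qy.
have [->|p0] := eqVneq p 0; first by rewrite mul0r msize0.
have [->|q0] := eqVneq q 0; first by rewrite mulr0 msize0.
rewrite msizeM //; move: px qy; move: (msize p) (msize q) => u v; lia.
Qed.

Lemma msize_prod_exp_le (K : fieldType) n k (F : nat -> {mpoly K[n]})
    (e : nat -> nat) (N D : nat) :
  (forall t, t < k -> msize (F t) <= D.+1)%N -> (forall t, e t <= N)%N ->
  (msize (\prod_(t < k) F t ^+ e t) <= (k * (N * D)).+1)%N.
Proof.
move=> FD eN; elim: k FD => [|k IHk] FD.
  by rewrite big_ord0 msize1.
rewrite big_ord_recr /= mulSnr; apply: msize_mul_le.
  by apply: IHk => t tk; apply: FD; apply: ltnW.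
have FkD := FD k (ltnSn k).
apply: (@leq_trans (e k * D).+1); last by rewrite ltnS leq_mul2r eN orbT.
elim: (e k) => [|m IHm]; first by rewrite expr0 msize1.
by rewrite exprS mulSn; apply: msize_mul_le.
Qed.

Lemma mpoly_in_ideal (K : fieldType) n (A : {set 'I_n})
    (Q : idealr {mpoly K[n]}) (f : {mpoly K[n]}) :
  (forall i, i \in A -> 'X_i \in Q) ->
  (forall m, m \in msupp f -> exists2 i, i \in A & m i != 0%N) -> f \in Q.
Proof.
move=> XQ fA; rewrite [f]mpolyE big_seq; apply: rpred_sum => m /fA[i Ai mi].
rewrite -mul_mpolyC; apply: idealMr; rewrite mpolyXE_id (bigD1 i) //= mulrC.
by apply: idealMr; rewrite -(prednK (n := m i)) ?lt0n // exprSr idealMr ?XQ.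
Qed.

Lemma quot_chain_bound (K : fieldType) n (A : {set 'I_n})
    (P : prime_idealr {mpoly K[n]}) k (c : 'I_k.+1 -> prime_idealr {ideal_quot
      P}) :
  (forall i, i \in A -> 'X_i \in P) -> prime_chain c -> (k <= #|~: A|)%N.
Proof.
move=> XP chc; set b := #|~: A|; rewrite leqNgt; apply/negP => ltbk.
(* [pc] and, below, [F] extend the finite families to all natural indices, as [chain_independent]
   takes them; the values beyond the chain are arbitrary. *)
pose pc t := c (inord t).
have [f fP] : exists f : 'I_k -> {mpoly K[n]}, forall t : 'I_k,
    \pi_{ideal_quot P} (f t) \in pc t.+1 /\
    \pi_{ideal_quot P} (f t) \notin pc t.
  apply: (fin_all_exists (P := fun (t : 'I_k) f =>
    \pi_{ideal_quot P} f \in pc t.+1 /\ \pi_{ideal_quot P} f \notin pc t)) => t.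
  apply: NNPP => noF.
  have [] := chc (inord t) (inord t.+1).
    by rewrite !inordK // ltnS // ltnW.
  move=> _; apply => y yc; apply/negPn/negP => ync; apply: noF.
  by exists (repr y); rewrite reprK.
pose F t := if insub t is Some u then f u else 0.
pose D := \max_(t < k) msize (f t).
(* The N ^ k products of powers f_t ^ e_t with e_t < N have degree less than
   N * C, so modulo the variables in A they are combinations of (N * C) ^ b
   monomials, and N is chosen to make (N * C) ^ b smaller than N ^ k. *)
pose C := (k * D).+1.
pose N := (C ^ b).+1.
pose e (s : k.-tuple 'I_N) t := nth 0%N (map val s) t.
pose G s := \prod_(t < k) F t ^+ e s t.
have FD t : (t < k -> msize (F t) <= D.+1)%N.
  move=> tk; rewrite /F insubT; apply: leqW.
  exact: (leq_bigmax (Ordinal tk)).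
have eN s t : (e s t <= N)%N.
  have [tk|kt] := ltnP t k.
    by rewrite /e (nth_map ord0) ?size_tuple //; exact: (ltnW (ltn_ord _)).
  by rewrite /e nth_default // size_map size_tuple.
have GM s : (msize (G s) <= (k * (N * D)).+1)%N by apply: msize_prod_exp_le.
pose J := {ffun {i | i \in ~: A} -> 'I_(N * C)}.
pose mon (j : J) : 'X_{1..n} :=
  [multinom if insub i is Some u then val (j u) else 0%N | i < n].
have [|g [[s0 g0] gJ]] := @linear_dependence K (k.-tuple 'I_N) J
    (fun s j => (G s)@_(mon j)).
  (* Since [b < k], [N ^ k] is at least [N ^ b * N], and [N] exceeds [C ^ b]. *)
  rewrite card_tuple card_ffun card_sig !card_ord expnMn.
  apply: leq_trans (leq_pexp2l _ ltbk); last by [].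
  by rewrite expnSr ltn_pmul2l ?expn_gt0.
pose H := \sum_s (g s)%:MP * G s.
(* A monomial of [H] free of the variables in [A] has exponents below [N * C], hence is some
   [mon j], where the coefficient of [H] vanishes by the choice of [g]. *)
have HP : H \in P.
  apply: mpoly_in_ideal XP _ => m mH; apply: NNPP => mA.
  have mA0 i : i \in A -> m i = 0%N.
    by move=> Ai; apply/eqP; apply/negPn/negP => mi; apply: mA; exists i.
  have mlt i : (m i < N * C)%N.
    have le_mi : (m i <= mdeg m)%N by rewrite mdegE (bigD1 i) //= leq_addr.
    apply: leq_ltn_trans le_mi _.
    have : (msize H <= (k * (N * D)).+1)%N.
      apply: leq_trans (msize_sum _ _ _) _; apply/bigmax_leqP => s _.
      by rewrite mul_mpolyC; apply: leq_trans (msizeZ_le _ _) (GM s).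
    move/(leq_trans (msize_mdeg_lt mH))/leq_trans; apply.
    by rewrite /C /N; nia.
  pose j : J := [ffun u => Ordinal (mlt (val u))].
  have jm : mon j = m.
    apply/mnmP => i; rewrite mnmE; case: insubP => [u _ <-|]; first
      by rewrite ffunE.
    by rewrite inE negbK => /mA0.
  move: mH; rewrite mcoeff_msupp /H raddf_sum /=.
  under eq_bigr do rewrite mcoeffCM.
  by rewrite -jm gJ eqxx.
(* This is the image of [H] in the quotient: zero because [H] is in [P], yet outside the first prime
   of the chain by independence. *)
have : \sum_(s in [set s | g s != 0]) \pi_{ideal_quot P} (g s)%:MP *
    \prod_(t < k) \pi_{ideal_quot P} (F t) ^+ e s t \notin pc 0%N.
  apply: (chain_independent (\pi_{ideal_quot P} \o @mpolyC n K) (c := g)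
    (P := pc) (f := fun t => \pi_{ideal_quot P} (F t)) (e := e)).
  - move=> t tk; have [fc fn] := fP (Ordinal tk).
    rewrite /F insubT /=; split=> //.
    have [] // := chc (inord t) (inord t.+1).
    by rewrite !inordK // ltnS // ltnW.
  - by move=> s /[!inE].
  - by apply/set0Pn; exists s0; rewrite inE.
  move=> s s' _ _ ess'; apply: val_inj; apply: (inj_map val_inj).
  apply: (@eq_from_nth _ 0%N) => [|t]; rewrite !size_map !size_tuple //.
  exact: ess'.
suff -> : \sum_(s in [set s | g s != 0]) \pi_{ideal_quot P} (g s)%:MP *
    \prod_(t < k) \pi_{ideal_quot P} (F t) ^+ e s t = 0 by rewrite idealr0.
transitivity (\pi_{ideal_quot P} H); last first.
  by move: HP; rewrite -{1}[H]subr0 Quotient.idealrBE => /eqP ->;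
    rewrite raddf0.
rewrite /H raddf_sum /= big_mkcond /=; apply: eq_bigr => s _.
rewrite inE rmorphM rmorph_prod; case: eqP => /= [->|_].
  by rewrite mpolyC0 raddf0 mul0r.
by congr (_ * _); apply: eq_bigr => t _; rewrite rmorphXn.
Qed.

(** As [Q] contains [P], it is a union of cosets of [P], so membership of a class can be tested on
    its chosen representative. *)
Lemma quot_prime_ex (R : comNzRingType) (P Q : prime_idealr R) :
  {subset P <= Q} ->
  exists Q' : prime_idealr {ideal_quot P},
    forall x, (\pi_{ideal_quot P} x \in Q') = (x \in Q).
Proof.
move=> PQ; pose q (y : {ideal_quot P}) := repr y \in Q.
have piq x : (\pi x \in q) = (x \in Q).
  have xP : repr (\pi_{ideal_quot P} x) - x \in P
    by rewrite Quotient.idealrBE reprK.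
  have -> : (\pi_{ideal_quot P} x \in q) = (repr (\pi_{ideal_quot P} x) \in Q)
    by [].
  by rewrite -[repr _](subrK x) (rpredDl _ (PQ _ xP)).
have qI : idealr_closed q.
  split=> [||a u v].
  - by rewrite -(rmorph0 (\pi_{ideal_quot P})) piq rpred0.
  - by rewrite -(rmorph1 (\pi_{ideal_quot P})) piq idealr1.
  rewrite -[a]reprK -[u]reprK -[v]reprK !piq => uQ vQ.
  by rewrite -rmorphM -rmorphD piq rpredD ?idealMr.
have qP : prime_idealr_closed q.
  move=> u v; rewrite -[u]reprK -[v]reprK -rmorphM !piq.
  by rewrite prime_idealrM.
pose iI := isIdealr.Build _ q qI.
pose iP := isPrimeIdealrClosed.Build _ q qP.
pose Q' : prime_idealr _ := HB.pack q iI iP.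
by exists Q'.
Qed.

(** * Primes generated by variables and the dimension of their quotients *)

Section CoordinatePrime.
Variables (K : fieldType) (n : nat) (A : {set 'I_n}).
Implicit Types (f g : {mpoly K[n]}) (Q : prime_idealr {mpoly K[n]}).

Definition kill_vars (i : 'I_n) : {mpoly K[n]} := if i \in A then 0 else 'X_i.

(** Defined as the kernel of a substitution into a domain, the ideal is a boolean predicate and
    visibly prime; [coord_prime_sub] shows that the variables in [A] generate it. *)
Definition coord_prime f : bool := mmap (@mpolyC n K) kill_vars f == 0.

Lemma mem_coord_prime f :
  (f \in coord_prime) = (mmap (@mpolyC n K) kill_vars f == 0).
Proof. by []. Qed.

Lemma coord_prime_idealr_closed : idealr_closed coord_prime.
Proof.
split=> [||a u v]; rewrite !mem_coord_prime ?rmorph0 ?rmorph1 ?oner_eq0 //.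
by move=> /eqP u0 /eqP v0; rewrite rmorphD rmorphM /= u0 v0 mulr0 addr0.
Qed.

Lemma coord_prime_prime_idealr_closed : prime_idealr_closed coord_prime.
Proof. by move=> u v; rewrite !mem_coord_prime rmorphM mulf_eq0. Qed.

HB.instance Definition _ :=
  isIdealr.Build {mpoly K[n]} coord_prime coord_prime_idealr_closed.
HB.instance Definition _ :=
  isPrimeIdealrClosed.Build {mpoly K[n]} coord_prime
    coord_prime_prime_idealr_closed.

Lemma mem_coord_primeX (u : 'X_{1..n}) :
  ('X_[u] \in coord_prime) = [exists i in A, u i != 0%N].
Proof.
rewrite mem_coord_prime mmapX.
apply/idP/exists_inP => [/prodf_eq0[i _]|[i Ai ui]]; last first.
  by apply/prodf_eq0; exists i; rewrite // /kill_vars Ai expr0n (negPf ui).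
rewrite /kill_vars; have [Ai|nAi] := boolP (i \in A).
  have [->|ui] := eqVneq (u i) 0%N; first by rewrite expr0 oner_eq0.
  by move=> _; exists i.
by rewrite mpolyXn -msize_poly_eq0 msizeX.
Qed.

Lemma mem_coord_primeXU i : ('X_i \in coord_prime) = (i \in A).
Proof.
rewrite mem_coord_primeX; apply/exists_inP/idP => [[j Aj]|Ai].
  by rewrite mnm1E; case: (i =P j) => /= [->|].

by exists i; rewrite // mnm1E eqxx.
Qed.

(** An element of the kernel equals itself minus its image. Monomial by monomial, this difference is
    0 if no variable of [A] occurs, and otherwise a multiple of such a variable. *)
Lemma coord_prime_sub Q :
  (forall i, i \in A -> 'X_i \in Q) -> {subset coord_prime <= Q}.
Proof.
move=> XQ f; rewrite mem_coord_prime => /eqP f0.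
rewrite -[f]subr0 -f0 {1}[f]mpolyE /mmap -sumrB; apply: rpred_sum => m _.
rewrite -mul_mpolyC -mulrBr idealMr // -mmap1_id /mmap1.
have [/exists_inP[i Ai mi]|] := boolP [exists i in A, m i != 0%N].
  rewrite [X in _ - X](bigD1 i) //= [kill_vars i]ifT // expr0n (negPf mi) mul0r
    subr0.
  rewrite (bigD1 i) //= mulrC idealMr //.
  by rewrite -(prednK (n := m i)) ?lt0n // exprSr idealMr ?XQ.
rewrite negb_exists_in => /forall_inP mA.
rewrite (eq_bigr (fun i => kill_vars i ^+ m i)) ?subrr ?rpred0 // => i _.
rewrite /kill_vars; case: ifP => // /mA; rewrite negbK => /eqP ->.
by rewrite !expr0.
Qed.

End CoordinatePrime.

(** The variables outside [A] are adjoined one at a time. For [i < j], the entry of [s] at position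
    [i] gives a variable in the prime of [B j] but not in that of [B i]. *)
Lemma coord_prime_chain (K : fieldType) n (A : {set 'I_n})
    (P : prime_idealr {mpoly K[n]}) :
  P =i coord_prime (K := K) A ->
  exists c : 'I_#|~: A|.+1 -> prime_idealr {ideal_quot P}, prime_chain c.
Proof.
move=> PA; pose s := enum (~: A).
pose B (j : nat) : {set 'I_n} := A :|: [set i in take j s].
have PB (j : nat) : {subset P <= coord_prime (K := K) (B j)}.
  move=> f; rewrite PA; apply: (coord_prime_sub (Q := coord_prime (B j))) => i
    Ai.
  by rewrite mem_coord_primeXU inE Ai.
have [c cP] := fin_all_exists
  (P := fun (j : 'I_#|~: A|.+1) (Q' : prime_idealr {ideal_quot P}) =>
     forall x, (\pi_{ideal_quot P} x \in Q') = (x \in coord_prime (B j)))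
  (fun j => quot_prime_ex (PB j)).
exists c => i j ltij; split=> [y|sub].
  rewrite -[y]reprK !cP.
  apply: (coord_prime_sub (Q := coord_prime (B j))) => l.
  rewrite mem_coord_primeXU !inE => /orP[->//|li]; apply/orP; right.
  rewrite -(subnKC (ltnW ltij)) takeD mem_cat li //.
have lt_is : (i < size s)%N by rewrite -cardE; have := ltn_ord j; lia.
have [i0 _] : exists i0 : 'I_n, i0 \in s.
  by case: (s) lt_is => // x s' _; exists x; rewrite mem_head.
pose x := nth i0 s i.
have: \pi_{ideal_quot P} 'X_x \in c j.
  rewrite cP mem_coord_primeXU !inE; apply/orP; right.
  rewrite /x -(nth_take i0 ltij) mem_nth // size_takel //.
  by rewrite -cardE -ltnS.
move/sub; rewrite cP mem_coord_primeXU !inE => /orP[|].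
  by have := mem_nth i0 lt_is; rewrite mem_enum inE => /negPf ->.
case/(nthP i0) => l; rewrite size_takel ?(ltnW lt_is) // => lti.
rewrite nth_take // => /eqP; rewrite nth_uniq ?enum_uniq //.
  by move/eqP=> eli; rewrite eli ltnn in lti.
exact: ltn_trans lti lt_is.
Qed.

Lemma coord_prime_krull_dim (K : fieldType) n (A : {set 'I_n})
    (P : prime_idealr {mpoly K[n]}) :
  P =i coord_prime (K := K) A -> has_krull_dim {ideal_quot P} #|~: A|.
Proof.
move=> PA; split; first exact: coord_prime_chain.
move=> k c; apply: quot_chain_bound => i Ai.
by rewrite PA mem_coord_primeXU.
Qed.

Lemma krull_dim_unique (R : comNzRingType) m m' :
  has_krull_dim R m -> has_krull_dim R m' -> m = m'.
Proof.
move=> [[c chc] mub] [[c' chc'] mub'].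
by apply/eqP; rewrite eqn_leq (mub' _ _ chc) (mub _ _ chc').
Qed.

(** While the degree is below the total bound on [C], some exponent in [C] can still be raised. *)
Lemma bounded_degree_mnm n (a : 'I_n -> nat) (C : {set 'I_n}) d :
  (d <= \sum_(i in C) a i)%N ->
  exists u : 'X_{1..n},
    [/\ mdeg u = d, forall i, (u i <= a i)%N & forall i, u i != 0%N -> i \in C].
Proof.
elim: d => [_|d IHd ltd].
  by exists 0%MM; rewrite mdeg0; split=> // i; rewrite mnm0E.
have [u [ud ua uC]] := IHd (ltnW ltd).
have [i Ci ltui] : exists2 i, i \in C & (u i < a i)%N.
  apply/exists_inP; apply: contraLR ltd;
    rewrite negb_exists_in => /forall_inP le_au.
  rewrite -leqNgt -ud mdegE [leqRHS](bigID [in C]) /=;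
    apply: leq_trans _ (leq_addr _ _).
  by apply: leq_sum => i /le_au; rewrite -leqNgt.
exists (u + U_(i))%MM; split=> [|j|j].
- by rewrite mdegD ud mdeg1 addn1.
- by rewrite mnmDE mnm1E; case: (i =P j) => [<-|_]; rewrite ?addn1 ?addn0.
by rewrite mnmDE mnm1E; case: (i =P j) => [<-|_] //; rewrite addn0; apply: uC.
Qed.

(** * Minimal primes of the ideal of Veronese type *)

Section VeroneseMinimalPrimes.
Variables (K : fieldType) (n d : nat) (a : 'I_n -> nat).
Implicit Types (P Q : prime_idealr {mpoly K[n]}) (A B : {set 'I_n}).

Definition var_set Q : {set 'I_n} := [set i | 'X_i \in Q].

(** A prime contains a monomial iff it contains one of its variables. A heavy complement of
    [var_set Q] supports a generator, which then avoids [Q]; a light one is too small to support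
    any. *)
Lemma prime_over_veronese Q :
  prime_over (veronese_ideal K d a) Q <-> light d a (~: var_set Q).
Proof.
split=> [IQ|lQ f].
  rewrite /light ltnNge; apply/negP => /bounded_degree_mnm[u [ud ua uC]].
  have: 'X_[u] \in Q.
    apply: IQ; exists [:: (1, 'X_[u])]; last by rewrite big_seq1 mul1r.
    by move=> v; rewrite inE => /eqP -> /=; exists u.
  rewrite mpolyXE_id; apply/negP.
  apply: (big_ind (fun f => f \notin Q)); first by rewrite idealr1.
    by move=> f g fQ gQ; rewrite prime_idealrM negb_or fQ.
  move=> i _; have [->|/uC] := eqVneq (u i) 0%N; first by rewrite idealr1.
  rewrite !inE; elim: (u i) => [|m IHm] Xi; first by rewrite idealr1.
  by rewrite exprS prime_idealrM negb_or Xi IHm.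
case=> s sG ->; rewrite big_seq; apply: rpred_sum => v /sG[u [ud ua ->]].
apply: idealMr; rewrite mpolyXE_id.
have [i ui Xi] : exists2 i, u i != 0%N & 'X_i \in Q.
  apply/exists_inP; apply: contraLR lQ;
    rewrite negb_exists_in => /forall_inP uQ.
  rewrite -leqNgt -ud mdegE (bigID (mem (~: var_set Q))) /= addnC big1 ?leq_sum
    //.
  move=> i; rewrite !inE negbK => Xi; apply/eqP/negPn/negP => /uQ.
  by rewrite Xi.
by rewrite (bigD1 i) //= mulrC idealMr // -(prednK (n := u i)) ?lt0n // exprSr
  idealMr.
Qed.

Lemma var_set_coord_prime A : var_set (coord_prime (K := K) A) = A.
Proof. by apply/setP=> i; rewrite inE mem_coord_primeXU. Qed.

(** Whether a prime contains the ideal depends only on its variables, so a minimal [P] equals the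
    coordinate prime of [var_set P] inside it. Larger light sets then correspond to smaller
    primes. *)
Lemma minimal_prime_veronese P :
  minimal_prime (veronese_ideal K d a) P <->
  exists2 B, maxset (light d a) B & P =i coord_prime (K := K) (~: B).
Proof.
split=> [[IP minP]|[B /maxsetP[lB maxB] PB]].
  have CP : {subset coord_prime (K := K) (var_set P) <= P}.
    by apply: coord_prime_sub => i; rewrite inE.
  have PC : {subset P <= coord_prime (K := K) (var_set P)}.
    apply: (minP (coord_prime (var_set P))) CP.
    by apply/prime_over_veronese; rewrite var_set_coord_prime;
      apply/prime_over_veronese.
  exists (~: var_set P); last by move=> f; rewrite setCK;
    apply/idP/idP => [/PC|/CP].
  apply/maxsetP; split=> [|B lB sB]; first exact/prime_over_veronese.
  apply/eqP; rewrite eqEsubset sB andbT; apply/subsetP=> i Bi.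
  (* A light [B] containing the complement of [var_set P] gives a prime over the ideal inside [P],
     which by minimality contains [P]; so no variable of [P] has its index in [B]. *)
  have: {subset P <= coord_prime (K := K) (~: B)}.
    apply: (minP (coord_prime (~: B))).
      by apply/prime_over_veronese; rewrite var_set_coord_prime setCK.
    apply: coord_prime_sub => j; rewrite inE => Bj; apply: CP.
    rewrite mem_coord_primeXU; apply: contraR Bj => Xj.
    by apply: (subsetP sB); rewrite inE.
  by rewrite inE => /(_ 'X_i); apply: contraPN => /[!inE] Xi /(_ Xi);
    rewrite mem_coord_primeXU inE Bi.
have vP : var_set P = ~: B.
  by apply/setP=> i; rewrite [LHS]inE PB mem_coord_primeXU.
split=> [|Q IQ QP f]; first by apply/prime_over_veronese; rewrite vP setCK.
rewrite PB; apply: coord_prime_sub => i.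
have <- : ~: var_set Q = B.
  apply: maxB; first exact/prime_over_veronese.
  rewrite -[B]setCK setCS -vP; apply/subsetP=> j /[!inE]; exact: QP.
by rewrite setCK inE.
Qed.

Lemma equidimensional_veronese :
  equidimensional (veronese_ideal K d a) <->
  exists m, forall B, maxset (light d a) B -> #|B| = m.
Proof.
split=> -[m mP]; exists m.
  move=> B maxB; pose P : prime_idealr _ := coord_prime (K := K) (~: B).
  have dimP : has_krull_dim {ideal_quot P} m.
    by apply: mP; apply/minimal_prime_veronese; exists B.
  have := coord_prime_krull_dim (P := P) (A := ~: B) (fun=> erefl).
  by rewrite setCK => /krull_dim_unique; apply.
move=> P /minimal_prime_veronese[B maxB /coord_prime_krull_dim].
by rewrite setCK (mP B).
Qed.

End VeroneseMinimalPrimes.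

End Algebra.

Theorem corollary2p8 (K : fieldType) (n d : nat) (a : 'I_n -> nat)
    (d_ge1 : 1 <= d)
    (a_le_d : forall i : 'I_n, a i <= d)
    (a_noninc : forall i j : 'I_n, i <= j -> a j <= a i)
    (sum_a : d <= \sum_(i < n) a i) :
  equidimensional (veronese_ideal K d a) <->
  exists p l : nat, maximal_admissible d a p l.
Proof.
apply: iff_trans (equidimensional_veronese K d a) _.
split=> [[m mP]|[p [l [[l1 lp pn [dw _] offs] _]]]].
  have [p [l]] := admissible_of_card_maxset d_ge1 a_noninc sum_a mP.
  exact: maximal_admissible_of_admissible.
exists (n - (p - l).+1) => B; apply: card_maxset_light_of_offsets => //.
by rewrite l1.
Qed.
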